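(* Let $\Gamma\in\mathbb R^{P\times n}$ with $P\ge n$. If $\Gamma$ has full column rank and the constraint gradients $\nabla I_1(\mathbf q),\nabla I_2(\mathbf q),\dots,\nabla I_m(\mathbf q)\in\mathbb R^n$ are linearly independent, then the solution $\dot{\mathbf q}$ of the regularized minimization problem $$\min_{\dot{\mathbf q}\in\mathbb R^n}\ \hat{\mathcal J}(\mathbf q,\dot{\mathbf q}),\qquad \hat{\mathcal J}(\mathbf q,\dot{\mathbf q})=\frac12\|\hat u_t-F(\hat u)\|_H^2+\frac12\|\Gamma\dot{\mathbf q}\|_2^2,$$ $$\text{subject to}\quad I_k(\mathbf q(t))=I_k(\mathbf q(0)),\quad k=1,2,\dots,m,\ \forall t\ge 0,$$ satisfies $$\big(M(\mathbf q)+\Gamma^\top\Gamma\big)\dot{\mathbf q}=\mathbf f(\mathbf q)-\sum_{k=1}^m\hat\lambda_k\nabla I_k(\mathbf q).$$ The Lagrange multipliers $\hat{\boldsymbol\lambda}=(\hat\lambda_1,\dots,\hat\lambda_m)^\top$ are determined through the linear system $$\hat C(\mathbf q)\,\hat{\boldsymbol\lambda}=\hat{\mathbf b}(\mathbf q),$$ where $\hat C\in\mathbb R^{m\times m}$ has entries $$\hat C_{ij}=\big\langle\nabla I_j,(M+\Gamma^\top\Gamma)^{-1}\nabla I_i\big\rangle,\quad i,j\in\{1,\dots,m\},$$ and $\hat{\mathbf b}=(\hat b_1,\dots,\hat b_m)^\top\in\mathbb R^m$ is given by $$\hat b_i=\big\langle\nabla I_i,(M+\Gamma^\top\Gamma)^{-1}\mathbf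 f\big\rangle,\quad i=1,\dots,m.$$
   Context: Setting: $H$ is a real Hilbert space of functions on a domain $D\subseteq\mathbb R^d$ with inner product $\langle\cdot,\cdot\rangle_H$ and norm $\|\cdot\|_H$. $F$ is a (possibly nonlinear) differential operator, the right-hand side of the PDE $\partial u/\partial t=F(u)$. $\hat u(\cdot,\mathbf q)\in H$ is an approximate solution depending smoothly on parameters $\mathbf q=(q_1,\dots,q_n)\in\mathbb R^n$, with $\partial\hat u/\partial q_i\in H$ and $F(\hat u)\in H$; no further assumption (such as linear independence of the $\partial\hat u/\partial q_i$) is made. The parameters are functions of time, $\mathbf q=\mathbf q(t)$, and $$\hat u_t=\sum_{i=1}^n\frac{\partial\hat u}{\partial q_i}(\cdot,\mathbf q)\,\dot q_i .$$ The metric tensor $M(\mathbf q)\in\mathbb R^{n\times n}$ and the vector $\mathbf f(\mathbf q)\in\mathbb R^n$ are $$M_{ij}=\Big\langle\frac{\partial\hat u}{\partial q_i},\frac{\partial\hat u}{\partial q_j}\Big\rangle_H,\qquad f_i=\Big\langle\frac{\partial\hat u}{\partial q_i},F(\hat u)\Big\rangle_H .$$ $I_1,\dots,I_m:H\to\mathbb R$ are conserved quantities of the PDE, $I_k(\mathbf q)$ is shorthand for $I_k(\hat u(\cdot,\mathbf q))$ (assumed differentiable in $\mathbf q$), and $\nabla I_k(\mathbf q)\in\mathbb R^n$ is the gradient with respect to $\mathbf q$. $\langle\cdot,\cdot\rangle$ without subscript and $\|\cdot\|_2$ denote the Euclidean inner product and norm. The minimization is over the instantaneous velocity $\dot{\mathbf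 q}\in\mathbb R^n$ at a given parameter value $\mathbf q$. The constraints $I_k(\mathbf q(t))=I_k(\mathbf q(0))$ for all $t\ge0$ are understood through their equivalent time-differentiated form, i.e. as the constraints $\langle\nabla I_k(\mathbf q),\dot{\mathbf q}\rangle=0$, $k=1,\dots,m$, on $\dot{\mathbf q}$. *)

(* Defs.v *)
From HB Require Import structures.
From mathcomp Require Import all_boot all_order all_algebra.
From mathcomp Require Import all_classical all_reals all_analysis.

Set Implicit Arguments.
Unset Strict Implicit.
Unset Printing Implicit Defensive.

Import Order.TTheory GRing.Theory Num.Theory.
Import numFieldNormedType.Exports.

Local Open Scope classical_set_scope.
Local Open Scope ring_scope.

Section Euclidean.
Variables (R : realType) (n : nat).

Definition vdot (u v : 'cV[R]_n) : R := \sum_(i < n) u i 0 * v i 0.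

(* The library norm on 'cV[R]_n is the sup norm, hence this definition. *)
Definition norm2 (v : 'cV[R]_n) : R := Num.sqrt (vdot v v).

Definition pderiv (W : normedModType R) (g : 'cV[R]_n -> W) (q : 'cV[R]_n)
    (i : 'I_n) : W :=
  'D_(delta_mx i 0 : 'cV[R]_n) g q.

Definition grad (g : 'cV[R]_n -> R) (q : 'cV[R]_n) : 'cV[R]_n :=
  \col_i pderiv (g : 'cV[R]_n -> R^o) q i.

End Euclidean.

Section PDE.
Variables (R : realType) (H : normedModType R).

(* Strong solution on [0, T[ of du/dt = F(u), where domF is the domain of the
   operator F: the values of F outside domF are irrelevant. *)
Definition pde_solution (domF : set H) (F : H -> H) (T : R) (u : R -> H) :=
  [/\ {within `[0, T[, continuous u},
      forall t, 0 <= t < T -> domF (u t) &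
      forall t, 0 < t < T -> is_derive (t : R^o) 1 (u : R^o -> H) (F (u t))].

Definition conserved (domF : set H) (F : H -> H) (J : H -> R) :=
  forall (T : R) (u : R -> H), 0 < T -> pde_solution domF F T u ->
    forall t, 0 <= t < T -> J (u t) = J (u 0).

End PDE.

Section ReducedModel.
Variables (R : realType) (H : normedModType R) (ip : {dot H for idfun}).
Variables (n m P : nat).
Variables (F : H -> H) (uhat : 'cV[R]_n -> H) (I : 'I_m -> H -> R).
Variables (Gamma : 'M[R]_(P, n)) (q : 'cV[R]_n).

Definition uhat_t (v : 'cV[R]_n) : H :=
  \sum_(i < n) v i 0 *: pderiv uhat q i.

Definition metric : 'M[R]_n :=
  \matrix_(i, j) ip (pderiv uhat q i) (pderiv uhat q j).

Definition rhs : 'cV[R]_n := \col_i ip (pderiv uhat q i) (F (uhat q)).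

Definition gradI (k : 'I_m) : 'cV[R]_n := grad (I k \o uhat) q.

Definition cost (v : 'cV[R]_n) : R :=
  2^-1 * `|uhat_t v - F (uhat q)| ^+ 2 + 2^-1 * norm2 (Gamma *m v) ^+ 2.

(* The time derivative of the constraint I_k(q(t)) = I_k(q(0)) at velocity v. *)
Definition feasible (v : 'cV[R]_n) : Prop := forall k, vdot (gradI k) v = 0.

Definition is_solution (v : 'cV[R]_n) : Prop :=
  feasible v /\ forall w, feasible w -> cost v <= cost w.

Definition reg_metric : 'M[R]_n := metric + Gamma^T *m Gamma.

Definition constraint_mx : 'M[R]_m :=
  \matrix_(i, j) vdot (gradI j) (invmx reg_metric *m gradI i).

Definition constraint_rhs : 'cV[R]_m :=
  \col_i vdot (gradI i) (invmx reg_metric *m rhs).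

End ReducedModel.

(* Main.v *)
Require Import Defs.
From HB Require Import structures.
From mathcomp Require Import all_boot all_order all_algebra.
From mathcomp Require Import all_classical all_reals all_analysis.
From mathcomp Require Import ring.
Import Order.TTheory GRing.Theory Num.Theory.
Import numFieldNormedType.Exports.
Local Open Scope classical_set_scope.
Local Open Scope ring_scope.

(** The problem is a strictly convex quadratic program.  With [A] the
regularized metric, [f] the right-hand side and [G] the matrix whose columns
are the constraint gradients, bilinearity of the inner product of [H] gives

  cost w = cost v + (A v - f) . (w - v) + 1/2 (w - v) . A (w - v),

and feasibility of [v] reads [G^T v = 0].  The form [v . A v] is the sum of
the squared lengths of [uhat_t v] and [Gamma v]; full column rank of [Gamma]
makes the second term positive for [v != 0], whatever linear dependence there
is among the parameter derivatives.  So [A] is positive definite, hence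
invertible, and so is [C = G^T A^-1 G], because [G] is injective.

The multiplier [lambda = C^-1 b] therefore exists, and the velocity
[v = A^-1 (f - G lambda)] satisfies [G^T v = b - C lambda = 0].  At this [v]
the linear term of the expansion is [- lambda . G^T (w - v)], which vanishes
for every feasible [w]; what is left, [1/2 (w - v) . A (w - v)], is positive
unless [w = v].  Hence [v] is the unique solution
([kkt_feasible], [kkt_optimal]), and it satisfies the multiplier equation by
construction. *)

(** * Positive definite matrices *)

Section EuclideanDot.
Context {R : realType} {n : nat}.
Implicit Types u v w : 'cV[R]_n.

Lemma vdotE u v : vdot u v = (u^T *m v) 0 0.
Proof. by rewrite mxE; apply: eq_bigr => i _; rewrite mxE. Qed.

Lemma vdotC u v : vdot u v = vdot v u.
Proof. by apply: eq_bigr => i _; rewrite mulrC. Qed.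

Lemma vdotDr u v w : vdot u (v + w) = vdot u v + vdot u w.
Proof. by rewrite !vdotE mulmxDr mxE. Qed.

Lemma vdotNr u v : vdot u (- v) = - vdot u v.
Proof. by rewrite !vdotE mulmxN mxE. Qed.

Lemma vdotBl u v w : vdot (u - v) w = vdot u w - vdot v w.
Proof. by rewrite vdotC vdotDr vdotNr !(vdotC w). Qed.

Lemma vdot0l v : vdot 0 v = 0.
Proof. by rewrite vdotE trmx0 mul0mx mxE. Qed.

Lemma vdot_ge0 v : 0 <= vdot v v.
Proof. by apply: sumr_ge0 => i _; rewrite -expr2 sqr_ge0. Qed.

Lemma vdot_gt0 v : v != 0 -> 0 < vdot v v.
Proof.
move=> vn0; rewrite lt_def vdot_ge0 andbT; apply: contra vn0.
rewrite psumr_eq0 => [/allP h|i _]; last by rewrite -expr2 sqr_ge0.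
apply/eqP/colP => i; rewrite mxE; apply/eqP.
by rewrite -(orbb (v i 0 == 0)) -mulf_eq0; apply: h; rewrite mem_index_enum.
Qed.

End EuclideanDot.

Lemma vdot_mulmxr {R : realType} {n p : nat} (B : 'M[R]_(p, n)) u v :
  vdot u (B *m v) = vdot (B^T *m u) v.
Proof. by rewrite !vdotE trmx_mul trmxK mulmxA. Qed.

(** Symmetry is a separate hypothesis: invertibility follows from positivity
of the form alone. *)
Definition posdef {R : realType} {n : nat} (A : 'M[R]_n) :=
  forall v : 'cV[R]_n, v != 0 -> 0 < vdot v (A *m v).

Lemma posdef_unitmx {R : realType} {n : nat} {A : 'M[R]_n} :
  posdef A -> A \in unitmx.
Proof.
move=> Apos; rewrite -unitmx_tr -row_free_unit -kermx_eq0; apply/rowV0P => u.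
move=> /sub_kermxP uA0; apply/eqP; rewrite -[u]trmxK trmx_eq0.
apply: contraT => /Apos; rewrite -[A]trmxK -trmx_mul uA0 trmx0.
by rewrite vdotC vdot0l ltxx.
Qed.

Lemma invmx_sym {R : realType} {n : nat} {A : 'M[R]_n} :
  A^T = A -> (invmx A)^T = invmx A.
Proof. by move=> Asym; rewrite trmx_inv Asym. Qed.

(** With [y = A^-1 G x], the form of [G^T A^-1 G] at [x] is [y . A y], and [y]
is nonzero when [G x] is. *)
Lemma posdef_constraint {R : realType} {n m : nat} (A : 'M[R]_n)
    (G : 'M[R]_(n, m)) :
    A^T = A -> posdef A -> (forall x : 'cV_m, G *m x = 0 -> x = 0) ->
  posdef (G^T *m invmx A *m G).
Proof.
move=> Asym Apos Ginj x xn0; have Au := posdef_unitmx Apos.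
have yn0 : invmx A *m (G *m x) != 0.
  apply: contra xn0 => /eqP y0; apply/eqP/Ginj.
  by rewrite -[G *m x](mulKVmx Au) y0 mulmx0.
have := Apos _ yn0; rewrite mulKVmx // vdotC.
by rewrite -!mulmxA vdot_mulmxr trmxK.
Qed.

(** * Equality-constrained quadratic programs *)

Section QuadraticProgram.
Context {R : realType} {n m : nat} (A : 'M[R]_n) (G : 'M[R]_(n, m)).
Variables (f : 'cV[R]_n) (J : 'cV[R]_n -> R) (lambda : 'cV[R]_m).
Hypothesis Apos : posdef A.
Hypothesis J_expand : forall v w,
  J w = J v + vdot (A *m v - f) (w - v)
        + 2^-1 * vdot (w - v) (A *m (w - v)).

Let v := invmx A *m (f - G *m lambda).

(** The linear system for [lambda] is the constraint [G^T v = 0] with [v]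
eliminated. *)
Lemma kkt_feasible :
    G^T *m invmx A *m G *m lambda = G^T *m (invmx A *m f) -> G^T *m v = 0.
Proof. by move=> e; rewrite /v !mulmxBr -e !mulmxA subrr. Qed.

(** The gradient of [J] at [v] is [- G lambda], which is orthogonal to every
feasible displacement, so the first-order term of [J_expand] drops out. *)
Lemma kkt_optimal w : G^T *m v = 0 -> G^T *m w = 0 ->
  J w = J v + 2^-1 * vdot (w - v) (A *m (w - v)).
Proof.
move=> vfeas wfeas; rewrite (J_expand v); congr (_ + _).
have -> : A *m v - f = - (G *m lambda).
  by rewrite mulKVmx ?posdef_unitmx // addrC addKr.
rewrite vdotC vdotNr vdot_mulmxr mulmxBr vfeas wfeas subrr.
by rewrite vdot0l oppr0 addr0.
Qed.

End QuadraticProgram.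

(** * The regularized reduced model as a quadratic program *)

Lemma full_col_rank_inj {R : realType} {n p : nat} {B : 'M[R]_(p, n)} {x} :
  \rank B = n -> B *m x = 0 :> 'cV_p -> x = 0.
Proof.
move=> Bn Bx0; apply: trmx_inj; rewrite trmx0.
have Bfree : row_free B^T by rewrite /row_free mxrank_tr Bn.
by apply: (row_free_inj Bfree); rewrite mul0mx -trmx_mul Bx0 trmx0.
Qed.

Section ReducedQuadraticProgram.
Context {R : realType} {H : normedModType R} (ip : {dot H for idfun}).
Hypothesis ip_norm : forall x : H, ip x x = `|x| ^+ 2.
Context {n m P : nat}.
Variables (F : H -> H) (uhat : 'cV[R]_n -> H) (I : 'I_m -> H -> R).
Variables (Gamma : 'M[R]_(P, n)) (q : 'cV[R]_n).

Let U := uhat_t uhat q.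
Let A := reg_metric ip uhat Gamma q.
Let f := rhs ip F uhat q.

Lemma ipC x y : ip x y = ip y x.
Proof. by rewrite hermC /= expr0 mul1r. Qed.

Lemma ip_uhat_t v x : ip (U v) x = \sum_i v i 0 * ip (pderiv uhat q i) x.
Proof.
by rewrite linear_sumlz; apply: eq_bigr => i _; rewrite linearZl_LR.
Qed.

Lemma ip_uhat_t_rhs v : ip (U v) (F (uhat q)) = vdot v f.
Proof. by rewrite ip_uhat_t; apply: eq_bigr => i _; rewrite mxE. Qed.

Lemma ip_uhat_t_metric v w :
  ip (U v) (U w) = vdot v (metric ip uhat q *m w).
Proof.
rewrite ip_uhat_t; apply: eq_bigr => i _; rewrite mxE ipC ip_uhat_t.
by congr (_ * _); apply: eq_bigr => j _; rewrite mxE ipC mulrC.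
Qed.

Lemma reg_metric_dot v w :
  vdot v (A *m w) = ip (U v) (U w) + vdot (Gamma *m v) (Gamma *m w).
Proof.
rewrite mulmxDl vdotDr ip_uhat_t_metric -mulmxA; congr (_ + _).
by rewrite vdot_mulmxr trmxK.
Qed.

Lemma reg_metric_sym : A^T = A.
Proof.
rewrite /A /reg_metric linearD /= trmx_mul trmxK; congr (_ + _).
by apply/matrixP => i j; rewrite !mxE ipC.
Qed.

(** The metric alone is only semidefinite, the parameter derivatives being
possibly dependent; the strict inequality comes from [Gamma]. *)
Lemma reg_metric_posdef : \rank Gamma = n -> posdef A.
Proof.
move=> Gn v vn0; rewrite reg_metric_dot ip_norm.
apply: ltr_wpDl; first exact: sqr_ge0.
by apply: vdot_gt0; apply: contra vn0 => /eqP /(full_col_rank_inj Gn) ->.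
Qed.

(** Up to a constant the cost is [1/2 v . A v - v . f]; symmetry of [A] merges
the two cross terms of its expansion. *)
Lemma cost_expand v w :
  cost F uhat Gamma q w = cost F uhat Gamma q v + vdot (A *m v - f) (w - v)
    + 2^-1 * vdot (w - v) (A *m (w - v)).
Proof.
have costE x : cost F uhat Gamma q x = 2^-1 * vdot x (A *m x) - vdot x f
    + 2^-1 * `|F (uhat q)| ^+ 2.
  rewrite /cost /norm2 sqr_sqrtr ?vdot_ge0 // -!ip_norm reg_metric_dot.
  rewrite -ip_uhat_t_rhs -/(U x) (linearBl ip) !(linearBr ip) /=.
  rewrite (ipC (F _) (U x)).
  by field.
have Aswap : vdot w (A *m v) = vdot v (A *m w).
  by rewrite vdot_mulmxr reg_metric_sym vdotC.
rewrite !costE mulmxBr !vdotBl !vdotDr !vdotNr Aswap.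
rewrite ![vdot (A *m v) _]vdotC ![vdot f _]vdotC Aswap.
by field.
Qed.

Definition gradmx : 'M[R]_(n, m) := \matrix_(i, k) gradI uhat I q k i 0.

Lemma gradmx_mul (x : 'cV[R]_m) :
  gradmx *m x = \sum_(k < m) x k 0 *: gradI uhat I q k.
Proof.
apply/colP => i; rewrite summxE mxE; apply: eq_bigr => k _.
by rewrite !mxE mulrC.
Qed.

Lemma gradmx_tr_mul v k : (gradmx^T *m v) k 0 = vdot (gradI uhat I q k) v.
Proof. by rewrite mxE; apply: eq_bigr => i _; rewrite !mxE. Qed.

Lemma feasibleE v : feasible uhat I q v <-> gradmx^T *m v = 0.
Proof.
split=> [vfeas|v0 k]; last by rewrite -gradmx_tr_mul v0 mxE.
by apply/colP => k; rewrite gradmx_tr_mul vfeas mxE.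
Qed.

Lemma gradmx_inj (x : 'cV[R]_m) :
  free [seq gradI uhat I q k | k : 'I_m] -> gradmx *m x = 0 -> x = 0.
Proof.
rewrite gradmx_mul => gfree x0.
have /freeP gfreeP : free (mktuple (gradI uhat I q)) by [].
apply/colP => k; rewrite mxE; apply: (gfreeP (fun k => x k 0)).
by rewrite -[RHS]x0; apply: eq_bigr => i _; rewrite -tnth_nth tnth_mktuple.
Qed.

Lemma col_gradmx k : col k gradmx = gradI uhat I q k.
Proof. by apply/colP => i; rewrite !mxE. Qed.

(** Entry [(i, j)] of the constraint matrix pairs gradient [j] on the left
with gradient [i] on the right; symmetry of [A^-1] makes the order harmless. *)
Lemma constraint_mxE :
  constraint_mx ip uhat I Gamma q = gradmx^T *m invmx A *m gradmx.
Proof.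
apply/matrixP => i j; rewrite mxE vdotC -(invmx_sym reg_metric_sym).
rewrite -vdot_mulmxr -gradmx_tr_mul -col_gradmx colE !mulmxA -colE.
by rewrite mxE (invmx_sym reg_metric_sym).
Qed.

Lemma constraint_rhsE :
  constraint_rhs ip F uhat I Gamma q = gradmx^T *m (invmx A *m f).
Proof. by apply/colP => i; rewrite mxE gradmx_tr_mul. Qed.

End ReducedQuadraticProgram.

Theorem theorem3 (R : realType) (H : completeNormedModType R)
    (ip : {dot H for idfun}) (ip_norm : forall x : H, ip x x = `|x| ^+ 2)
    (n m P : nat) (domF : set H) (F : H -> H)
    (uhat : 'cV[R]_n -> H)
    (uhat_smooth : forall p, differentiable uhat p)
    (uhat_domF : forall p, domF (uhat p))
    (I : 'I_m -> H -> R)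
    (I_conserved : forall k, conserved domF F (I k))
    (I_diff : forall k p,
       differentiable (fun p' : 'cV[R]_n => I k (uhat p') : R^o) p)
    (Gamma : 'M[R]_(P, n)) (q : 'cV[R]_n)
    (n_le_P : (n <= P)%N)
    (Gamma_full_rank : \rank Gamma = n)
    (gradI_free : free [seq gradI uhat I q k | k : 'I_m]) :
  let A := reg_metric ip uhat Gamma q in
  let f := rhs ip F uhat q in
  let C := constraint_mx ip uhat I Gamma q in
  let b := constraint_rhs ip F uhat I Gamma q in
  [/\ A \in unitmx,
      C \in unitmx,
      exists! v, is_solution F uhat I Gamma q v &
      forall v, is_solution F uhat I Gamma q v ->
        exists lambda : 'cV[R]_m,
          A *m v = f - \sum_(k < m) lambda k 0 *: gradI uhat I q k
          /\ C *m lambda = b].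
Proof.
move=> A f C b.
have Apos : posdef A := reg_metric_posdef ip ip_norm uhat Gamma q Gamma_full_rank.
have Au : A \in unitmx := posdef_unitmx Apos.
set G := gradmx uhat I q.
have CE : C = G^T *m invmx A *m G by apply: constraint_mxE.
have Cu : C \in unitmx.
  rewrite CE; apply/posdef_unitmx/posdef_constraint => //.
    exact: reg_metric_sym.
  by move=> x; apply: gradmx_inj.
pose lambda := invmx C *m b; pose v := invmx A *m (f - G *m lambda).
have Clambda : C *m lambda = b by rewrite mulKVmx.
have vfeas : G^T *m v = 0.
  by apply: kkt_feasible; rewrite -CE Clambda; apply: constraint_rhsE.
have gap w : feasible uhat I q w -> cost F uhat Gamma q w =
    cost F uhat Gamma q v + 2^-1 * vdot (w - v) (A *m (w - v)).
  move=> /feasibleE; apply: kkt_optimal => //.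
  exact: cost_expand.
have vsol : is_solution F uhat I Gamma q v.
  split=> [|w wfeas]; first exact/feasibleE.
  rewrite (gap w) // lerDl mulr_ge0 ?invr_ge0 //.
  have [->|/Apos/ltW//] := eqVneq (w - v) 0; by rewrite vdot0l.
have vuniq w : is_solution F uhat I Gamma q w -> v = w.
  case=> wfeas wmin; apply/esym/eqP; rewrite -subr_eq0.
  apply: contraT => /Apos wv_gt0.
  have := wmin v vsol.1; rewrite (gap w) // gerDl pmulr_rle0 ?invr_gt0 //.
  by rewrite leNgt wv_gt0.
split=> //; first by exists v.
move=> w /vuniq <-; exists lambda; split=> //.
by rewrite mulKVmx // -gradmx_mul.
Qed.
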